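(* Let $n\in\mathbb{N}$. For all $0<q<1$ there is an isomorphism of C*-algebras $C(S^{2n+1}_q)\cong C(S^{2n+1}_0)$.
   Context: $\mathbb{N}=\{0,1,2,\dots\}$. For $n\in\mathbb{N}$ and a real number $0\leq q<1$, $\mathcal{A}(S^{2n+1}_q)$ denotes the unital associative complex *-algebra generated by elements $\{z_i,z_i^*\}_{i=0}^n$ (with $z_i^*$ the adjoint of $z_i$) with relations (a) $z_jz_i=q\,z_iz_j$ for all $0\leq i<j\leq n$; (b) $z_i^*z_j=q\,z_jz_i^*$ for all $0\leq i\neq j\leq n$; (c) $z_i^*z_i=z_iz_i^*+(1-q^2)\sum_{j=i+1}^n z_jz_j^*$ for all $0\leq i\leq n$; (d) $z_0z_0^*+z_1z_1^*+\ldots+z_nz_n^*=1$. An empty sum is $0$. $C(S^{2n+1}_q)$ denotes the universal C*-algebra (C*-enveloping algebra) of $\mathcal{A}(S^{2n+1}_q)$ in the category of unital algebras and unital homomorphisms: a unital C*-algebra with a unital *-homomorphism $\phi_u:\mathcal{A}(S^{2n+1}_q)\to C(S^{2n+1}_q)$ such that every unital *-homomorphism $f$ from $\mathcal{A}(S^{2n+1}_q)$ to a unital C*-algebra $C$ factors as $f=\widetilde f\circ\phi_u$ for a unique unital *-homomorphism $\widetilde f:C(S^{2n+1}_q)\to C$. It exists and is the completion of the quotient of $\mathcal{A}(S^{2n+1}_q)$ by the kernel of the universal C*-seminorm $\|a\|_u=\sup\{\|\rho(a)\|:\rho\text{ a bounded *-representation of }\mathcal{A}(S^{2n+1}_q)\}$.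 *)

(* Defs.v *)
From HB Require Import structures.
From mathcomp Require Import all_boot all_order all_algebra.
From mathcomp Require Import generic_quotient complex.
From mathcomp Require Import boolp reals.

Set Implicit Arguments.
Unset Strict Implicit.
Unset Printing Implicit Defensive.

Import Order.TTheory GRing.Theory Num.Theory.
Local Open Scope ring_scope.
Local Open Scope complex_scope.
Local Open Scope quotient_scope.

HB.mixin Record Algebra_hasStar (R : realType) A of GRing.Algebra R[i] A := {
  star : A -> A;
  starK : involutive star;
  starD : {morph star : x y / x + y};
  starM : forall x y : A, star (x * y) = star y * star x;
  starZ : forall (c : R[i]) (x : A), star (c *: x) = Num.conj c *: star x
}.

#[short(type="starAlgType")]
HB.structure Definition StarAlgebra (R : realType) :=
  {A of GRing.Algebra R[i] A & Algebra_hasStar R A}.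

(* The norm and its completeness are spelled out because HB cannot declare a
   structure joining GRing.Algebra with CompleteNormedModule after
   Num.NumDomain. *)
HB.mixin Record StarAlgebra_isCstar (R : realType) A of StarAlgebra R A := {
  cnorm : A -> R;
  cnorm_eq0 : forall x : A, cnorm x = 0 -> x = 0;
  cnormD_le : forall x y : A, cnorm (x + y) <= cnorm x + cnorm y;
  cnormZ : forall (c : R[i]) (x : A), (cnorm (c *: x))%:C = `|c| * (cnorm x)%:C;
  cnormM_le : forall x y : A, cnorm (x * y) <= cnorm x * cnorm y;
  cnorm_starM : forall x : A, cnorm (star x * x) = cnorm x ^+ 2;
  cnorm_complete : forall u : nat -> A,
    (forall e : R, 0 < e -> exists N : nat, forall m k : nat,
       (N <= m)%N -> (N <= k)%N -> cnorm (u m - u k) < e) ->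
    exists l : A, forall e : R, 0 < e -> exists N : nat, forall m : nat,
      (N <= m)%N -> cnorm (u m - l) < e
}.

#[short(type="cstarAlgType")]
HB.structure Definition CstarAlgebra (R : realType) :=
  {A of StarAlgebra R A & StarAlgebra_isCstar R A}.

Definition star_hom (R : realType) (A B : starAlgType R) (f : A -> B) : Prop :=
  [/\ linear f, f 1 = 1, {morph f : x y / x * y}
    & forall x, f (star x) = star (f x)].

Definition cstar_isomorphic (R : realType) (A B : cstarAlgType R) : Prop :=
  exists2 f : A -> B, star_hom f & bijective f.

Definition cstar_envelope (R : realType) (A : starAlgType R)
    (U : cstarAlgType R) (phi : A -> U) : Prop :=
  star_hom phi /\
  forall (C : cstarAlgType R) (f : A -> C), star_hom f ->
    exists! g : U -> C, star_hom g /\ f = g \o phi.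

Section StarTheory.
Context {R : realType} {A : starAlgType R}.

Lemma star0 : star (0 : A) = 0.
Proof. by apply: (addrI (star 0)); rewrite -starD !addr0. Qed.

Lemma star1 : star (1 : A) = 1.
Proof. by have := starM (star (1 : A)) 1; rewrite mulr1 starK mulr1. Qed.

End StarTheory.

Inductive star_term (R : realType) (n : nat) : Type :=
| Gen of 'I_n.+1
| Zero
| One
| Add of star_term R n & star_term R n
| Mul of star_term R n & star_term R n
| Scale of R[i] & star_term R n
| Star of star_term R n.

Arguments Gen {R n}.
Arguments Zero {R n}.
Arguments One {R n}.

HB.instance Definition _ R n := gen_eqMixin (star_term R n).
HB.instance Definition _ R n := gen_choiceMixin (star_term R n).

(* The smallest congruence on terms containing the unital *-algebra axioms and
   the defining relations of the quantum sphere. *)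
Inductive sphere_eqv (R : realType) (n : nat) (q : R) :
    star_term R n -> star_term R n -> Prop :=
| EqvRefl x : sphere_eqv q x x
| EqvSym x y : sphere_eqv q x y -> sphere_eqv q y x
| EqvTrans y x z : sphere_eqv q x y -> sphere_eqv q y z -> sphere_eqv q x z
| EqvAdd x x' y y' : sphere_eqv q x x' -> sphere_eqv q y y' ->
    sphere_eqv q (Add x y) (Add x' y')
| EqvMul x x' y y' : sphere_eqv q x x' -> sphere_eqv q y y' ->
    sphere_eqv q (Mul x y) (Mul x' y')
| EqvScale c x x' : sphere_eqv q x x' -> sphere_eqv q (Scale c x) (Scale c x')
| EqvStar x x' : sphere_eqv q x x' -> sphere_eqv q (Star x) (Star x')
| EqvAddA x y z : sphere_eqv q (Add x (Add y z)) (Add (Add x y) z)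
| EqvAddC x y : sphere_eqv q (Add x y) (Add y x)
| EqvAdd0 x : sphere_eqv q (Add Zero x) x
| EqvAddN x : sphere_eqv q (Add (Scale (-1) x) x) Zero
| EqvMulA x y z : sphere_eqv q (Mul x (Mul y z)) (Mul (Mul x y) z)
| EqvMul1l x : sphere_eqv q (Mul One x) x
| EqvMul1r x : sphere_eqv q (Mul x One) x
| EqvMulDl x y z : sphere_eqv q (Mul (Add x y) z) (Add (Mul x z) (Mul y z))
| EqvMulDr x y z : sphere_eqv q (Mul x (Add y z)) (Add (Mul x y) (Mul x z))
| EqvScaleA a b x : sphere_eqv q (Scale a (Scale b x)) (Scale (a * b) x)
| EqvScale1 x : sphere_eqv q (Scale 1 x) x
| EqvScaleDr a x y :
    sphere_eqv q (Scale a (Add x y)) (Add (Scale a x) (Scale a y))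
| EqvScaleDl a b x :
    sphere_eqv q (Scale (a + b) x) (Add (Scale a x) (Scale b x))
| EqvScaleMl a x y : sphere_eqv q (Scale a (Mul x y)) (Mul (Scale a x) y)
| EqvScaleMr a x y : sphere_eqv q (Scale a (Mul x y)) (Mul x (Scale a y))
| EqvStarK x : sphere_eqv q (Star (Star x)) x
| EqvStarD x y : sphere_eqv q (Star (Add x y)) (Add (Star x) (Star y))
| EqvStarM x y : sphere_eqv q (Star (Mul x y)) (Mul (Star y) (Star x))
| EqvStarZ a x : sphere_eqv q (Star (Scale a x)) (Scale (Num.conj a) (Star x))
| EqvSphereA (i j : 'I_n.+1) : (i < j)%N ->
    sphere_eqv q (Mul (Gen j) (Gen i)) (Scale q%:C (Mul (Gen i) (Gen j)))
| EqvSphereB (i j : 'I_n.+1) : i != j ->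
    sphere_eqv q (Mul (Star (Gen i)) (Gen j))
                 (Scale q%:C (Mul (Gen j) (Star (Gen i))))
| EqvSphereC (i : 'I_n.+1) :
    sphere_eqv q (Mul (Star (Gen i)) (Gen i))
      (Add (Mul (Gen i) (Star (Gen i)))
           (Scale (1 - q ^+ 2)%:C
              (\big[@Add R n/Zero]_(j < n.+1 | (i < j)%N)
                 Mul (Gen j) (Star (Gen j)))))
| EqvSphereD :
    sphere_eqv q (\big[@Add R n/Zero]_(j < n.+1) Mul (Gen j) (Star (Gen j)))
                 One.

Definition sphere_relations (R : realType) (n : nat) (q : R)
    (A : starAlgType R) (z : 'I_n.+1 -> A) : Prop :=
  [/\ forall i j : 'I_n.+1, (i < j)%N -> z j * z i = q%:C *: (z i * z j),
      forall i j : 'I_n.+1, i != j ->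
        star (z i) * z j = q%:C *: (z j * star (z i)),
      forall i : 'I_n.+1, star (z i) * z i = z i * star (z i) +
        (1 - q ^+ 2)%:C *: \sum_(j < n.+1 | (i < j)%N) z j * star (z j)
    & \sum_(j < n.+1) z j * star (z j) = 1].

Fixpoint term_eval (R : realType) (n : nat) (A : starAlgType R)
    (z : 'I_n.+1 -> A) (t : star_term R n) : A :=
  match t with
  | Gen i => z i
  | Zero => 0
  | One => 1
  | Add x y => term_eval z x + term_eval z y
  | Mul x y => term_eval z x * term_eval z y
  | Scale c x => c *: term_eval z x
  | Star x => star (term_eval z x)
  end.

Lemma term_eval_eqv (R : realType) (n : nat) (q : R) (A : starAlgType R)
    (z : 'I_n.+1 -> A) : sphere_relations q z ->
  forall s t, sphere_eqv q s t -> term_eval z s = term_eval z t.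
Proof.
move=> [rA rB rC rD] s t; elim=> {s t} //=.
- by move=> y x w _ -> _ ->.
- by move=> x x' y y' _ -> _ ->.
- by move=> x x' y y' _ -> _ ->.
- by move=> c x x' _ ->.
- by move=> x x' _ ->.
- by move=> *; rewrite addrA.
- by move=> *; rewrite addrC.
- by move=> *; rewrite add0r.
- by move=> *; rewrite scaleN1r addNr.
- by move=> *; rewrite mulrA.
- by move=> *; rewrite mul1r.
- by move=> *; rewrite mulr1.
- by move=> *; rewrite mulrDl.
- by move=> *; rewrite mulrDr.
- by move=> *; rewrite scalerA.
- by move=> *; rewrite scale1r.
- by move=> *; rewrite scalerDr.
- by move=> *; rewrite scalerDl.
- by move=> *; rewrite scalerAl.
- by move=> *; rewrite scalerAr.
- by move=> *; rewrite starK.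
- by move=> *; rewrite starD.
- by move=> *; rewrite starM.
- by move=> *; rewrite starZ.
- move=> i; rewrite rC; congr (_ + _ *: _).
  by rewrite (big_morph (term_eval z) (id1 := 0) (op1 := +%R)).
- by rewrite (big_morph (term_eval z) (id1 := 0) (op1 := +%R)).
Qed.

(* The complex numbers as a *-algebra, needed only to see that the presented
   algebra is not zero. *)
Definition complex_star (R : realType) : Type := R[i].
Section ComplexStar.
Variable R : realType.
HB.instance Definition _ := GRing.ComAlgebra.copy (complex_star R) (R[i])^o.
Fact complex_starZ (c : R[i]) (x : complex_star R) :
  Num.conj (c *: x : R[i]) = c^* *: (Num.conj (x : R[i]) : complex_star R).
Proof. exact: rmorphM. Qed.
Fact complex_starM (x y : complex_star R) :
  Num.conj (x * y : R[i]) = (Num.conj (y : R[i]) * Num.conj (x : R[i]) : complex_star R).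
Proof. by rewrite mulrC; exact: rmorphM. Qed.
HB.instance Definition _ := Algebra_hasStar.Build R (complex_star R)
  (@conjCK R[i]) (rmorphD Num.conj) complex_starM complex_starZ.
End ComplexStar.

Section SphereAlgebra.
Variables (R : realType) (n : nat) (q : R).

Definition sphere_eqvb (s t : star_term R n) : bool := `[< sphere_eqv q s t >].

Fact sphere_eqvb_refl : reflexive sphere_eqvb.
Proof. by move=> x; apply/asboolP; exact: EqvRefl. Qed.

Fact sphere_eqvb_sym : symmetric sphere_eqvb.
Proof. by move=> x y; apply/asboolP/asboolP => /EqvSym. Qed.

Fact sphere_eqvb_trans : transitive sphere_eqvb.
Proof.
move=> y x z /asboolP xy /asboolP yz; apply/asboolP; exact: EqvTrans xy yz.
Qed.

Canonical sphere_equiv :=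
  EquivRel sphere_eqvb sphere_eqvb_refl sphere_eqvb_sym sphere_eqvb_trans.

Definition sphere_alg : Type := {eq_quot sphere_equiv}.

HB.instance Definition _ := Choice.on sphere_alg.
HB.instance Definition _ := EqQuotient.on sphere_alg.

Lemma sphere_piP (s t : star_term R n) :
  sphere_eqv q s t <-> \pi_sphere_alg s = \pi_sphere_alg t.
Proof.
split=> [h|/eqmodP]; last by move/asboolP.
by apply/eqmodP; apply/asboolP.
Qed.

Lemma sphere_reprP (s : star_term R n) :
  sphere_eqv q (repr (\pi_sphere_alg s)) s.
Proof. by apply/sphere_piP; rewrite reprK. Qed.

Let add (x y : sphere_alg) : sphere_alg := \pi_sphere_alg (Add (repr x) (repr y)).
Let mul (x y : sphere_alg) : sphere_alg := \pi_sphere_alg (Mul (repr x) (repr y)).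
Let scale (c : R[i]) (x : sphere_alg) : sphere_alg := \pi_sphere_alg (Scale c (repr x)).
Let st (x : sphere_alg) : sphere_alg := \pi_sphere_alg (Star (repr x)).

Let piD s t : add (\pi_sphere_alg s) (\pi_sphere_alg t) = \pi_sphere_alg (Add s t).
Proof. by apply/sphere_piP/EqvAdd; exact: sphere_reprP. Qed.
Let piM s t : mul (\pi_sphere_alg s) (\pi_sphere_alg t) = \pi_sphere_alg (Mul s t).
Proof. by apply/sphere_piP/EqvMul; exact: sphere_reprP. Qed.
Let piZ c s : scale c (\pi_sphere_alg s) = \pi_sphere_alg (Scale c s).
Proof. by apply/sphere_piP/EqvScale; exact: sphere_reprP. Qed.
Let piS s : st (\pi_sphere_alg s) = \pi_sphere_alg (Star s).
Proof. by apply/sphere_piP/EqvStar; exact: sphere_reprP. Qed.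

Let piW (P : sphere_alg -> Prop) : (forall s, P (\pi_sphere_alg s)) -> forall x, P x.
Proof. by move=> h x; rewrite -[x]reprK. Qed.

Fact sphere_addA : associative add.
Proof.
elim/piW=> x; elim/piW=> y; elim/piW=> z; rewrite !piD.
exact/sphere_piP/EqvAddA.
Qed.
Fact sphere_addC : commutative add.
Proof. elim/piW=> x; elim/piW=> y; rewrite !piD; exact/sphere_piP/EqvAddC. Qed.
Fact sphere_add0 : left_id (\pi_sphere_alg Zero) add.
Proof. elim/piW=> x; rewrite !piD; exact/sphere_piP/EqvAdd0. Qed.
Fact sphere_addN : left_inverse (\pi_sphere_alg Zero) (scale (-1)) add.
Proof. elim/piW=> x; rewrite !piZ !piD; exact/sphere_piP/EqvAddN. Qed.

HB.instance Definition _ := GRing.isZmodule.Build sphere_alg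
  sphere_addA sphere_addC sphere_add0 sphere_addN.

Fact sphere_mulA : associative mul.
Proof.
elim/piW=> x; elim/piW=> y; elim/piW=> z; rewrite !piM.
exact/sphere_piP/EqvMulA.
Qed.
Fact sphere_mul1l : left_id (\pi_sphere_alg One) mul.
Proof. elim/piW=> x; rewrite !piM; exact/sphere_piP/EqvMul1l. Qed.
Fact sphere_mul1r : right_id (\pi_sphere_alg One) mul.
Proof. elim/piW=> x; rewrite !piM; exact/sphere_piP/EqvMul1r. Qed.
Fact sphere_mulDl : left_distributive mul add.
Proof.
elim/piW=> x; elim/piW=> y; elim/piW=> z; rewrite piD !piM piD.
exact/sphere_piP/EqvMulDl.
Qed.
Fact sphere_mulDr : right_distributive mul add.
Proof.
elim/piW=> x; elim/piW=> y; elim/piW=> z; rewrite piD !piM piD.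
exact/sphere_piP/EqvMulDr.
Qed.

(* z_0 |-> 1 and z_i |-> 0 for i > 0 defines a character. *)
Fact sphere_1_neq0 : \pi_sphere_alg One != 0.
Proof.
pose z (i : 'I_n.+1) : complex_star R := if i == ord0 then 1 else 0.
have z0 : z ord0 = 1 by rewrite /z eqxx.
have zN i : i != ord0 -> z i = 0 by rewrite /z => /negPf ->.
have zpos (i j : 'I_n.+1) : (i < j)%N -> z j = 0.
  by move=> ij; apply: zN; apply: contraTneq ij => ->.
have zz (i j : 'I_n.+1) : i != j -> z i = 0 \/ z j = 0.
  case: (eqVneq i ord0) => [->|/zN]; last by left.
  by rewrite eq_sym => /zN; right.
have rel : sphere_relations q z.
  split=> [i j ij|i j /zz[]->|i|].
  - by rewrite (zpos _ _ ij) mul0r mulr0 scaler0.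
  - by rewrite star0 mul0r mulr0 scaler0.
  - by rewrite mul0r mulr0 scaler0.
  - rewrite big1 ?scaler0 ?addr0; first exact: mulrC.
    by move=> j /zpos ->; rewrite mul0r.
  - rewrite (bigD1 ord0) //= z0 big1 ?star1 ?mulr1 ?addr0 //.
    by move=> j /zN ->; rewrite mul0r.
apply/eqP => /sphere_piP /(term_eval_eqv rel) /= /eqP.
by rewrite oner_eq0.
Qed.

HB.instance Definition _ := GRing.Zmodule_isNzRing.Build sphere_alg
  sphere_mulA sphere_mul1l sphere_mul1r sphere_mulDl sphere_mulDr
  sphere_1_neq0.

Fact sphere_scaleA (a b : R[i]) (x : sphere_alg) :
  scale a (scale b x) = scale (a * b) x.
Proof.
by elim/piW: x => x; rewrite !piZ; exact/sphere_piP/EqvScaleA.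
Qed.
Fact sphere_scale1 : left_id 1 scale.
Proof. elim/piW=> x; rewrite piZ; exact/sphere_piP/EqvScale1. Qed.
Fact sphere_scaleDr : right_distributive scale +%R.
Proof.
move=> a; elim/piW=> x; elim/piW=> y; rewrite [_ + _]piD !piZ [RHS]piD.
exact/sphere_piP/EqvScaleDr.
Qed.
Fact sphere_scaleDl (x : sphere_alg) : {morph scale^~ x : a b / a + b}.
Proof.
elim/piW: x => x a b; rewrite /= !piZ [RHS]piD; exact/sphere_piP/EqvScaleDl.
Qed.

HB.instance Definition _ := GRing.Zmodule_isLmodule.Build R[i] sphere_alg
  sphere_scaleA sphere_scale1 sphere_scaleDr sphere_scaleDl.

Fact sphere_scaleMl (a : R[i]) (x y : sphere_alg) : a *: (x * y) = (a *: x) * y.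
Proof.
elim/piW: x => x; elim/piW: y => y.
rewrite [_ * _]piM [LHS]piZ [a *: _]piZ [RHS]piM; exact/sphere_piP/EqvScaleMl.
Qed.
HB.instance Definition _ :=
  GRing.Lmodule_isLalgebra.Build R[i] sphere_alg sphere_scaleMl.

Fact sphere_scaleMr (a : R[i]) (x y : sphere_alg) : a *: (x * y) = x * (a *: y).
Proof.
elim/piW: x => x; elim/piW: y => y.
rewrite [_ * _]piM [LHS]piZ [a *: _]piZ [RHS]piM; exact/sphere_piP/EqvScaleMr.
Qed.
HB.instance Definition _ :=
  GRing.Lalgebra_isAlgebra.Build R[i] sphere_alg sphere_scaleMr.

Fact sphere_starK : involutive st.
Proof. elim/piW=> x; rewrite !piS; exact/sphere_piP/EqvStarK. Qed.
Fact sphere_starD : {morph st : x y / x + y}.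
Proof.
elim/piW=> x; elim/piW=> y; rewrite [_ + _]piD !piS [RHS]piD.
exact/sphere_piP/EqvStarD.
Qed.
Fact sphere_starM (x y : sphere_alg) : st (x * y) = st y * st x.
Proof.
elim/piW: x => x; elim/piW: y => y; rewrite [_ * _]piM !piS [RHS]piM.
exact/sphere_piP/EqvStarM.
Qed.
Fact sphere_starZ (c : R[i]) (x : sphere_alg) :
  st (c *: x) = Num.conj c *: st x.
Proof.
elim/piW: x => x; rewrite [_ *: _]piZ !piS [RHS]piZ.
exact/sphere_piP/EqvStarZ.
Qed.

HB.instance Definition _ := Algebra_hasStar.Build R sphere_alg
  sphere_starK sphere_starD sphere_starM sphere_starZ.

Definition sphere_gen (i : 'I_n.+1) : sphere_alg := \pi_sphere_alg (Gen i).

Lemma sphere_pi_eval (t : star_term R n) :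
  term_eval sphere_gen t = \pi_sphere_alg t.
Proof.
elim: t => //= [x -> y ->|x -> y ->|c x ->|x ->].
- exact: piD.
- exact: piM.
- exact: piZ.
- exact: piS.
Qed.

Lemma sphere_gen_relations : sphere_relations q sphere_gen.
Proof.
have ev s t : sphere_eqv q s t ->
    term_eval sphere_gen s = term_eval sphere_gen t.
  by rewrite !sphere_pi_eval => /sphere_piP.
split=> [i j ij|i j ij|i|].
- exact: (ev _ _ (EqvSphereA q ij)).
- exact: (ev _ _ (EqvSphereB q ij)).
- have /= := ev _ _ (EqvSphereC q i).
  by rewrite (big_morph (term_eval sphere_gen) (id1 := 0) (op1 := +%R)).
- have /= := ev _ _ (EqvSphereD n q).
  by rewrite (big_morph (term_eval sphere_gen) (id1 := 0) (op1 := +%R)).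
Qed.

Lemma sphere_alg_universal (A : starAlgType R) (z : 'I_n.+1 -> A) :
  sphere_relations q z ->
  exists! f : sphere_alg -> A, star_hom f /\ forall i, f (sphere_gen i) = z i.
Proof.
move=> rel; pose f (x : sphere_alg) := term_eval z (repr x).
have fE t : f (\pi_sphere_alg t) = term_eval z t.
  exact: (term_eval_eqv rel) (sphere_reprP t).
exists f; split.
  split; last by move=> i; rewrite fE.
  split.
  - move=> a; elim/piW=> x; elim/piW=> y.
    by rewrite [_ *: _]piZ [_ + _]piD !fE.
  - exact: fE.
  - by elim/piW=> x; elim/piW=> y; rewrite [_ * _]piM !fE.
  - by elim/piW=> x; rewrite [star _]piS !fE.
move=> g [[gL g1 gM gS] gz]; apply/funext; elim/piW=> t; rewrite fE.
have g0 : g 0 = 0.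
  by have := gL (-1) 0 0; rewrite scaler0 add0r scaleN1r addNr.
have gD x y : g (x + y) = g x + g y by rewrite -{1}[x]scale1r gL scale1r.
have gZ c x : g (c *: x) = c *: g x by rewrite -[c *: x]addr0 gL g0 addr0.
elim: t => [i|||x IHx y IHy|x IHx y IHy|c x IHx|x IHx] /=.
- by rewrite -gz.
- by rewrite -g0.
- by rewrite -g1.
- by rewrite IHx IHy -piD -gD.
- by rewrite IHx IHy -piM -gM.
- by rewrite IHx -piZ -gZ.
- by rewrite IHx -piS -gS.
Qed.

End SphereAlgebra.

(* Main.v *)
Require Import Defs.
From mathcomp Require Import all_boot all_order all_algebra.
From mathcomp Require Import complex reals.
From mathcomp Require Import boolp.
From mathcomp Require Import lra.

Import Order.TTheory GRing.Theory Num.Theory.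
Local Open Scope ring_scope.
Local Open Scope complex_scope.

Set Implicit Arguments.
Unset Strict Implicit.
Unset Printing Implicit Defensive.

(** Both algebras are given by generators and relations, so an isomorphism amounts
    to a natural and invertible way of turning tuples that satisfy the relations at
    [q] into tuples that satisfy them at 0, inside an arbitrary C*-algebra.

    Let [z, z_1, ..., z_n] satisfy the relations at [q] and put [x = 1 - z z^*],
    the sum of the [z_j z_j^*].  Then [z^* z = 1 - q^2 x] is invertible, so [z] has
    a polar decomposition [z = s (1 - q^2 x)^(1/2)] with [s] an isometry.  The
    projection [p = 1 - s s^*] is the spectral projection of [x] at 1, it commutes
    with the [z_j], and the cut-downs [z_j p] satisfy the same relations in the
    corner with unit [p], with one generator less.  The [z_j] come back from the
    cut-downs as the block diagonal operators
      [z_j = sum_k q^k s^k (z_j p) (s^k)^*].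
    Repeating this in smaller and smaller corners yields partial isometries that
    satisfy the relations at 0, and the construction can be run backwards.

    The relation [polar_link] records that two tuples correspond in this way.  Its
    existence statements are [isometries_exist] and [generators_exist]; each tuple
    determines the other ([polar_link_unique_isometries],
    [polar_link_unique_gens]); and homomorphisms preserve it ([polar_link_hom]).
    Hence the generators of each envelope induce a homomorphism out of the other
    one, and both composites fix the generators.

    Functional calculus, positivity and infinite series are replaced by three
    devices.  Square roots, inverses and the block diagonal sums are solutions of
    contractive equations, so that they are unique and inherit every commutation
    relation by subtracting two equations.  Norms of self-adjoint elements are
    bounded through the growth of their powers.  Finally, homomorphisms are
    contractive because a self-adjoint [a] of norm less than 1 is the real part of
    the unitary [a + i (1 - a^2)^(1/2)]. *)

(** * Powers in an Archimedean field *)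

Lemma expr_unbounded (R : realType) (a K : R) : 1 < a ->
  exists N : nat, forall m : nat, (N <= m)%N -> K < a ^+ m.
Proof.
move=> a1; have h0 : 0 < a - 1 by rewrite subr_gt0.
have bernoulli m : 1 + m%:R * (a - 1) <= a ^+ m.
  elim: m => [|m IHm]; first by rewrite mul0r addr0 expr0.
  rewrite exprS -natr1; have am : 1 <= a ^+ m by rewrite exprn_ege1 // ltW.
  nra.
exists (Num.bound (K / (a - 1))) => m Nm.
apply: lt_le_trans (bernoulli m); apply: ltr_wpDl => //.
rewrite -ltr_pdivrMr //; apply: le_lt_trans (ler_norm _) _.
apply: lt_le_trans (archi_boundP (normr_ge0 _)) _.
by rewrite ler_nat; apply: leq_trans Nm; rewrite /Num.bound normr_id.
Qed.

Lemma expr_small (R : realType) (r C e : R) : 0 <= r < 1 -> 0 <= C -> 0 < e ->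
  exists N : nat, C * r ^+ N < e.
Proof.
move=> /andP[r0 r1] C0 e0; case: (eqVneq r 0) => [->|rN0].
  by exists 1%N; rewrite expr1 mulr0.
have {}r0 : 0 < r by rewrite lt_neqAle eq_sym rN0.
have ri : 1 < r^-1 by rewrite invf_gt1.
have [N /(_ N (leqnn N)) hN] := expr_unbounded (C / e) ri.
exists N; rewrite -ltr_pdivlMr ?exprn_gt0 // mulrC -ltr_pdivrMr //.
by rewrite -exprVn.
Qed.

(** * The norm of a C*-algebra *)

Section Norm.
Context {R : realType} {A : cstarAlgType R}.
Implicit Types (a b : A).

Lemma complex_normR (c : R) : `|c%:C| = `|c|%:C.
Proof. by rewrite normc_def /= expr0n /= addr0 sqrtr_sqr. Qed.

Lemma star_scaleR (B : starAlgType R) (c : R) (x : B) :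
  star (c%:C *: x) = c%:C *: star x.
Proof.
by rewrite starZ; congr (_ *: _); apply/CrealP; rewrite complex_real.
Qed.

Lemma starN (B : starAlgType R) (x : B) : star (- x) = - star x.
Proof. by apply: (addrI (star x)); rewrite -starD !subrr star0. Qed.

Lemma starB (B : starAlgType R) (x y : B) : star (x - y) = star x - star y.
Proof. by rewrite starD starN. Qed.

Lemma cnormZR (c : R) a : cnorm (c%:C *: a) = `|c| * cnorm a.
Proof.
by apply: (@complexI R); rewrite cnormZ complex_normR -rmorphM.
Qed.

Lemma cnorm0 : cnorm (0 : A) = 0.
Proof. by have := cnormZR 0 (0 : A); rewrite scaler0 normr0 mul0r. Qed.

Lemma cnormN a : cnorm (- a) = cnorm a.
Proof. by have := cnormZR (-1) a; rewrite rmorphN1 scaleN1r normrN1 mul1r. Qed.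

Lemma cnormB_le a b : cnorm (a - b) <= cnorm a + cnorm b.
Proof. by rewrite -[cnorm b]cnormN cnormD_le. Qed.

Lemma cnorm_distC a b : cnorm (a - b) = cnorm (b - a).
Proof. by rewrite -cnormN opprB. Qed.

Lemma cnorm_ge0 a : 0 <= cnorm a.
Proof. by have := cnormB_le a a; rewrite subrr cnorm0; lra. Qed.

Lemma cnorm_star a : cnorm (star a) = cnorm a.
Proof.
have le b : cnorm b <= cnorm (star b).
  have [->|b0] := eqVneq (cnorm b) 0; first exact: cnorm_ge0.
  have bp : 0 < cnorm b by rewrite lt_neqAle eq_sym b0 cnorm_ge0.
  by rewrite -(ler_pM2r bp) -expr2 -cnorm_starM cnormM_le.
by apply/eqP; rewrite eq_le le andbT; have := le (star a); rewrite starK.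
Qed.

Lemma cnorm_proj_le1 a : star a * a = a -> cnorm a <= 1.
Proof.
by move=> h; have := cnorm_starM a; rewrite h expr2; have := cnorm_ge0 a; nra.
Qed.

Lemma cnorm1_le1 : cnorm (1 : A) <= 1.
Proof. by apply: cnorm_proj_le1; rewrite mulr1 star1. Qed.

Lemma cnorm_isometry_le1 a : cnorm (star a * a) <= 1 -> cnorm a <= 1.
Proof. by rewrite cnorm_starM; have := cnorm_ge0 a; nra. Qed.

Lemma cnorm_pow2n a j : star a = a -> cnorm (a ^+ (2 ^ j)) = cnorm a ^+ (2 ^ j).
Proof.
move=> sa; have sX m : star (a ^+ m) = a ^+ m.
  by elim: m => [|m IHm]; rewrite ?expr0 ?star1 // exprSr starM IHm sa -exprS -exprSr.
elim: j => [|j IHj]; first by rewrite expn0 !expr1.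
rewrite expnS mulnC !exprM -IHj -cnorm_starM sX expr2 //.
Qed.

(** The C*-identity gives the norm of [a ^+ (2 ^ j)] exactly, so the growth
    rate of the powers already bounds the norm of [a]. *)
Lemma cnorm_le_power_growth (K c : R) M a : star a = a -> 0 < c ->
  (forall m, (M <= m)%N -> cnorm (a ^+ m) <= K * c ^+ m) -> cnorm a <= c.
Proof.
move=> sa c0 bnd; rewrite leNgt; apply/negP => ca.
have [|N hN] := @expr_unbounded R (cnorm a / c) K; first by rewrite ltr_pdivlMr ?mul1r.
have le_pow m : (m <= M + N -> m <= 2 ^ (M + N))%N.
  by move/leq_trans; apply; exact/ltnW/ltn_expl.
have := hN (2 ^ (M + N))%N (le_pow _ (leq_addl _ _)).
rewrite expr_div_n ltr_pdivlMr ?exprn_gt0 // -cnorm_pow2n //.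
by rewrite ltNge bnd // le_pow // leq_addr.
Qed.

End Norm.

(** * Fixed points *)

Section FixedPoint.
Context {R : realType} {A : cstarAlgType R}.

(** Banach's theorem on a ball about 0.  For iterates of 0 the distance from
    [iter n F 0] to [iter (n + k) F 0] is at most [r ^+ n * rho]. *)
Lemma contraction_fixpoint (F : A -> A) (r rho : R) :
  0 <= r < 1 -> 0 <= rho ->
  (forall a, cnorm a <= rho -> cnorm (F a) <= rho) ->
  (forall a b, cnorm a <= rho -> cnorm b <= rho ->
     cnorm (F a - F b) <= r * cnorm (a - b)) ->
  exists2 a, cnorm a <= rho & F a = a.
Proof.
move=> r01 rho0 Fball Fctr; have /andP[r0 r1] := r01.
pose u n := iter n F 0.
have uball n : cnorm (u n) <= rho.
  by elim: n => [|n IHn]; rewrite /u /= ?cnorm0 //; exact: Fball.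
have udist n k : cnorm (u (n + k)%N - u n) <= rho * r ^+ n.
  elim: n => [|n IHn]; first by rewrite expr0 mulr1 subr0.
  rewrite addSn exprSr mulrA mulrC; apply: le_trans (Fctr _ _ _ _) _ => //.
  exact: ler_wpM2l.
have udist' N m : (N <= m)%N -> cnorm (u m - u N) <= rho * r ^+ N.
  by move=> Nm; rewrite -(subnKC Nm).
have [|l ul] := @cnorm_complete R A u.
  move=> e e0; have [N hN] := expr_small r01 rho0 (divr_gt0 e0 (@ltr0n R 2)).
  exists N => m k Nm Nk; have -> : u m - u k = (u m - u N) - (u k - u N).
    by rewrite opprB addrA subrK.
  apply: le_lt_trans (cnormB_le _ _) _.
  by move: (udist' _ _ Nm) (udist' _ _ Nk); lra.
have lball : cnorm l <= rho.
  apply/ler_addgt0Pr => e e0; have [N /(_ N (leqnn N)) hN] := ul e e0.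
  have -> : l = u N - (u N - l) by rewrite opprB addrC subrK.
  by apply: le_trans (cnormB_le _ _) _; apply: lerD => //; exact: ltW.
exists l => //; apply/eqP; rewrite -subr_eq0; apply/eqP/cnorm_eq0/eqP.
rewrite eq_le cnorm_ge0 andbT; apply/ler_addgt0Pr => e e0; rewrite add0r.
have [N hN] := ul _ (divr_gt0 e0 (@ltr0n R 2)).
have -> : F l - l = (F l - u N.+1) + (u N.+1 - l) by rewrite addrA subrK.
apply: le_trans (cnormD_le _ _) _.
move: (hN N.+1 (leqnSn N)) (hN N (leqnn N)) (Fctr _ _ lball (uball N)).
rewrite -[F (u N)]/(u N.+1) (cnorm_distC l).
by have := cnorm_ge0 (u N - l); nra.
Qed.

Lemma affine_fixpoint (L : A -> A) (r : R) (b : A) : 0 <= r < 1 ->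
  (forall x y, L x - L y = L (x - y)) -> (forall x, cnorm (L x) <= r * cnorm x) ->
  exists a, a = b + L a.
Proof.
move=> r01 LB Lr; have /andP[r0 r1] := r01.
have d0 : 0 < 1 - r by rewrite subr_gt0.
have rho0 : 0 <= cnorm b / (1 - r) by rewrite divr_ge0 ?cnorm_ge0 // ltW.
have [a ha|a c _ _|a _ ha] := @contraction_fixpoint (fun a => b + L a) r _ r01 rho0.
- apply: le_trans (cnormD_le _ _) _.
  have e : cnorm b = cnorm b / (1 - r) * (1 - r) by rewrite divfK // gt_eqF.
  rewrite {1}e; have := Lr a; set K := _ / _ in ha *; nra.
- by rewrite opprD addrACA subrr add0r LB.
- by exists a.
Qed.

Lemma contraction_eq0 (r : R) (a : A) : r < 1 -> cnorm a <= r * cnorm a -> a = 0.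
Proof.
move=> r1 ha; apply: cnorm_eq0; apply/eqP; rewrite eq_le cnorm_ge0 andbT.
by have := cnorm_ge0 a; nra.
Qed.

End FixedPoint.

(** * Square roots near the identity *)

(** [1 - w] is the square root of [1 - y] that is close to 1: among the solutions
    of the quadratic equation, the bound on [w] singles out one. *)
Definition sqrt_defect {R : realType} {A : cstarAlgType R} (y w : A) : Prop :=
  cnorm w < 1 /\ w + w = y + w * w.

Section SqrtDefect.
Context {R : realType} {A : cstarAlgType R}.
Implicit Types (a d e v w y : A).

Lemma sqrt_defectP y w : sqrt_defect y w -> (1 - w) * (1 - w) = 1 - y.
Proof.
case=> _ yw; have -> : y = w + w - w * w by rewrite yw addrK.
by rewrite mulrBl mul1r mulrBr mulr1 -addrA -opprD addrA.
Qed.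

(** The map [a |-> (y + a ^+ 2) / 2] preserves the ball of radius [cnorm y] and is
    contractive there with that same constant. *)
Lemma sqrt_defect_exists y : cnorm y < 1 -> exists w, sqrt_defect y w.
Proof.
move=> y1; have y0 := cnorm_ge0 y.
have half : `|(2^-1 : R)| = 2^-1 by rewrite ger0_norm // invr_ge0 ler0n.
have [|//|a ay|a b ay by_|w wy wE] :=
    @contraction_fixpoint R A (fun a => (2^-1)%:C *: (y + a * a)) (cnorm y) (cnorm y).
- by rewrite y0.
- rewrite cnormZR half; have := cnormD_le y (a * a); have := cnormM_le a a.
  by have := cnorm_ge0 a; nra.
- rewrite -scalerBr cnormZR half opprD addrACA subrr add0r.
  have -> : a * a - b * b = a * (a - b) + (a - b) * b.
    by rewrite mulrBr mulrBl addrA subrK.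
  have := cnormD_le (a * (a - b)) ((a - b) * b).
  have := cnormM_le a (a - b); have := cnormM_le (a - b) b.
  by have := cnorm_ge0 (a - b); have := cnorm_ge0 a; have := cnorm_ge0 b; nra.
exists w; split; first exact: le_lt_trans wy y1.
rewrite -{1 2}wE -scalerDl -rmorphD /= -mulr2n -(mulr_natr (2^-1 : R)) mulVf ?pnatr_eq0 //.
by rewrite rmorph1 scale1r.
Qed.

(** The difference of two square roots, or their commutation defect with another
    element, satisfies an equation of this shape. *)
Lemma halved_eq0 v w d : cnorm v < 1 -> cnorm w < 1 -> d + d = v * d + d * w -> d = 0.
Proof.
move=> v1 w1 dE; have hdd : cnorm (d + d) = 2 * cnorm d.
  rewrite -{1 2}[d]scale1r -scalerDl -[1 + 1]/(2%:R) -(rmorph_nat (real_complex R)).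
  by rewrite cnormZR normr_nat.
apply: (@contraction_eq0 R A ((cnorm v + cnorm w) / 2)); first lra.
move: hdd; rewrite dE => hdd; have := cnormD_le (v * d) (d * w).
by rewrite hdd; have := cnormM_le v d; have := cnormM_le d w; nra.
Qed.

Lemma sqrt_defect_intertwine a y y' w w' : sqrt_defect y w -> sqrt_defect y' w' ->
  a * y = y' * a -> a * w = w' * a.
Proof.
case=> w1 wE [w'1 w'E] ay; apply/eqP; rewrite -subr_eq0; apply/eqP.
apply: (halved_eq0 w'1 w1).
rewrite addrACA -opprD -(mulrDr a w w) -(mulrDl w' w' a) wE w'E mulrDr mulrDl ay opprD addrACA subrr add0r.
by rewrite mulrBr mulrBl !mulrA [RHS]addrC subrKA.
Qed.

Lemma sqrt_defect_unique y w w' : sqrt_defect y w -> sqrt_defect y w' -> w = w'.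
Proof.
move=> hw hw'; have := sqrt_defect_intertwine (a := 1) hw hw'.
by rewrite !mul1r !mulr1; apply.
Qed.

Lemma sqrt_defect_star y w : sqrt_defect y w -> star y = y -> star w = w.
Proof.
move=> hw sy; apply: sqrt_defect_unique (hw); case: hw => w1 wE.
by split; rewrite ?cnorm_star // -starD wE starD starM sy.
Qed.

Lemma sqrt_defect_corner e y w : sqrt_defect y w -> e * y = y -> e * w = w.
Proof.
case=> w1 wE ey; apply/eqP; rewrite -subr_eq0; apply/eqP.
apply: (@halved_eq0 0 w); rewrite ?cnorm0 ?ltr01 //.
rewrite addrACA -opprD -(mulrDr e w w) wE mulrDr ey opprD addrACA subrr add0r.
by rewrite mul0r add0r mulrBl mulrA.
Qed.

Lemma sqrt_defect_cancel a b w : cnorm w < 1 -> a * (1 - w) = b * (1 - w) -> a = b.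
Proof.
move=> w1 /eqP; rewrite -subr_eq0 -mulrBl mulrBr mulr1 subr_eq0 => /eqP ab.
apply/eqP; rewrite -subr_eq0; apply/eqP; apply: (contraction_eq0 w1).
by rewrite {1}ab mulrC cnormM_le.
Qed.

Lemma one_sub_invertible w : cnorm w < 1 ->
  exists u, u * (1 - w) = 1 /\ (1 - w) * u = 1.
Proof.
move=> w1; have w01 : 0 <= cnorm w < 1 by rewrite cnorm_ge0.
have [x y|x|u uE] := @affine_fixpoint R A (fun a => a * w) (cnorm w) 1 w01.
- by rewrite -mulrBl.
- by rewrite mulrC cnormM_le.
have u1 : u * (1 - w) = 1 by rewrite mulrBr mulr1 {1}uE addrK.
exists u; split=> //; apply: (sqrt_defect_cancel w1).
by rewrite -mulrA u1 mulr1 mul1r.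
Qed.

End SqrtDefect.

(** * Homomorphisms are contractive *)

Section Contractive.
Context {R : realType}.

Lemma star_hom0 (A B : starAlgType R) (f : A -> B) : star_hom f -> f 0 = 0.
Proof. by case=> fL _ _ _; have := fL (-1) 0 0; rewrite scaler0 addr0 scaleN1r addNr. Qed.

Lemma star_homD (A B : starAlgType R) (f : A -> B) : star_hom f -> {morph f : x y / x + y}.
Proof. by case=> fL _ _ _ x y; rewrite -{1}[x]scale1r fL scale1r. Qed.

Lemma star_homZ (A B : starAlgType R) (f : A -> B) (c : R[i]) (x : A) : star_hom f ->
  f (c *: x) = c *: f x.
Proof. by move=> fh; case: (fh) => fL _ _ _; rewrite -[c *: x]addr0 fL star_hom0 // addr0. Qed.

Lemma star_homB (A B : starAlgType R) (f : A -> B) : star_hom f -> {morph f : x y / x - y}.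
Proof. by move=> fh x y; rewrite star_homD // -scaleN1r star_homZ // scaleN1r. Qed.

Lemma star_hom_comp (A B C : starAlgType R) (f : A -> B) (g : B -> C) :
  star_hom f -> star_hom g -> star_hom (g \o f).
Proof.
move=> [fL f1 fM fS] [gL g1 gM gS]; split=> /=.
- by move=> c x y /=; rewrite fL gL.
- by rewrite f1.
- by move=> x y /=; rewrite fM gM.
- by move=> x; rewrite fS gS.
Qed.

Lemma star_hom_id (A : starAlgType R) : star_hom (@idfun A).
Proof. by split. Qed.

(** [a + i b] is unitary, and [a] is its real part. *)
Lemma cnorm_pythagoras_le1 (A : cstarAlgType R) (a b : A) : star a = a -> star b = b ->
  a * b = b * a -> a * a + b * b = 1 -> cnorm a <= 1.
Proof.
move=> sa sb ab1 sq; pose i : R[i] := 'i%R.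
have ii (x : A) : i *: (i *: x) = - x by rewrite scalerA -expr2 sqrCi scaleN1r.
have si (x : A) : star (i *: x) = - (i *: star x) by rewrite starZ conjCi scaleNr.
have u1 : cnorm (a + i *: b) <= 1.
  apply: cnorm_isometry_le1; rewrite starD si sa sb mulrBl !mulrDr.
  rewrite -!scalerAl -!scalerAr ii ab1 opprB addrACA subrr addr0 sq.
  exact: cnorm1_le1.
have v1 : cnorm (a - i *: b) <= 1.
  by rewrite -cnorm_star starB si sa sb opprK.
have h : a = (2^-1)%:C *: ((a + i *: b) + (a - i *: b)).
  rewrite addrACA subrr addr0 -mulr2n -scaler_nat scalerA -(rmorph_nat (real_complex R)) -rmorphM.
  by rewrite /= mulVf ?pnatr_eq0 // scale1r.
rewrite h cnormZR ger0_norm ?invr_ge0 ?ler0n //.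
by have := cnormD_le (a + i *: b) (a - i *: b); lra.
Qed.

(** A self-adjoint [x] with [cnorm x < 1] has the commuting self-adjoint companion
    [1 - w] with [x ^+ 2 + (1 - w) ^+ 2 = 1].  This identity is algebraic, so it
    holds for the images as well and bounds [f x] by 1. *)
Lemma star_hom_contractive (A B : cstarAlgType R) (f : A -> B) (a : A) :
  star_hom f -> cnorm (f a) <= cnorm a.
Proof.
move=> fh; have [_ f1 fM fS] := fh.
have unit_ball x : star x = x -> cnorm x < 1 -> cnorm (f x) <= 1.
  move=> sx x1; have [|w hw] := @sqrt_defect_exists R A (x * x).
    by apply: le_lt_trans (cnormM_le _ _) _; have := cnorm_ge0 x; nra.
  have sw := sqrt_defect_star hw; rewrite starM sx in sw.
  have xw := sqrt_defect_intertwine (a := x) hw hw (mulrA _ _ _).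
  apply: (@cnorm_pythagoras_le1 _ _ (f (1 - w))).
  - by rewrite -fS sx.
  - by rewrite -fS starB star1 sw.
  - by rewrite -!fM mulrBl mulrBr xw mul1r mulr1.
  - by rewrite -!fM (sqrt_defectP hw) -star_homD // addrC subrK.
have self_adjoint x : star x = x -> cnorm (f x) <= cnorm x.
  move=> sx; apply/ler_addgt0Pr => e e0; pose t := cnorm x + e.
  have t0 : 0 < t by apply: ltr_wpDl; rewrite ?cnorm_ge0.
  have := unit_ball (t^-1%:C *: x); rewrite star_scaleR sx star_homZ // !cnormZR.
  rewrite gtr0_norm ?invr_gt0 // !(mulrC t^-1) ltr_pdivrMr // ler_pdivrMr // !mul1r.
  by apply=> //; rewrite ltrDl.
have sq : cnorm (f a) ^+ 2 <= cnorm a ^+ 2.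
  by rewrite -!cnorm_starM -fS -fM self_adjoint // starM starK.
by move: sq; rewrite ler_pXn2r ?nnegrE ?cnorm_ge0 //.
Qed.

Lemma sqrt_defect_hom (A B : cstarAlgType R) (f : A -> B) (y w : A) :
  star_hom f -> sqrt_defect y w -> sqrt_defect (f y) (f w).
Proof.
move=> fh [w1 wE]; split; first exact: le_lt_trans (star_hom_contractive _ fh) w1.
by case: (fh) => _ _ fM _; rewrite -fM -star_homD // wE star_homD.
Qed.

End Contractive.

(** * Sphere systems in corners *)

Section Systems.
Context {R : realType} {A : starAlgType R}.
Implicit Types (q : R) (e p s v z : A) (l zs : seq A).

Definition mass l : A := \sum_(v <- l) v * star v.

(** The homogeneous relations among the generators listed from [z_0] on; the list
    form lets inductions drop the first generator.  The relation between [z_i^*] and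
    [z_j] is stated for one order of the indices, the other being its adjoint. *)
Fixpoint sphere_rel q l : Prop :=
  if l is z :: zs then
    [/\ {in zs, forall v, v * z = q%:C *: (z * v)},
        {in zs, forall v, star v * z = q%:C *: (z * star v)},
        star z * z = z * star z + (1 - q ^+ 2)%:C *: mass zs
      & sphere_rel q zs]
  else True.

(** All relations, in the corner cut out by the projection [e], which takes the
    place of the unit.  The empty list is allowed and forces [e = 0]; it
    starts the inductions on the number of generators. *)
Definition sphere_system q e l : Prop :=
  [/\ e * e = e, star e = e, mass l = e, sphere_rel q l
    & {in l, forall v, e * v = v /\ v * e = v}].

Lemma mass_nil : mass [::] = 0.
Proof. exact: big_nil. Qed.

Lemma mass_cons v l : mass (v :: l) = v * star v + mass l.
Proof. exact: big_cons. Qed.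

Lemma star_mass l : star (mass l) = mass l.
Proof.
elim: l => [|v l IHl]; first by rewrite mass_nil star0.
by rewrite mass_cons starD starM starK IHl.
Qed.

Lemma range_compl_proj e s : e * e = e -> star e = e -> star s * s = e ->
  e * s = s -> s * e = s -> let p := e - s * star s in
  [/\ p * p = p, star p = p, p * s = 0, star s * p = 0 & e * p = p /\ p * e = p].
Proof.
move=> ee se sse es s_e p.
have sp : star p = p by rewrite starB se starM starK.
have ps : p * s = 0 by rewrite mulrBl -mulrA sse es s_e subrr.
have spz : star s * p = 0 by rewrite -sp -starM ps star0.
have s'e : star s * e = star s by rewrite -se -starM es.
have ep : e * p = p by rewrite mulrBr ee mulrA es.
have pe : p * e = p by rewrite mulrBl ee -mulrA s'e.
by split=> //; rewrite mulrBr pe mulrA ps mul0r subr0.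
Qed.

Lemma mass_cut (p : A) l : p * p = p -> star p = p ->
  {in l, forall v, v * p = p * v} -> mass [seq v * p | v <- l] = mass l * p.
Proof.
move=> pp sp; elim: l => [|v l IHl] lp; first by rewrite !mass_nil mul0r.
rewrite /= !mass_cons mulrDl IHl; last by move=> a al; rewrite lp // inE al orbT.
have v'p : star v * p = p * star v by rewrite -sp -!starM lp ?mem_head.
by rewrite starM sp mulrA -(mulrA v) pp -mulrA -v'p mulrA.
Qed.

(** A projection commuting with the generators commutes with their adjoints too,
    so cutting down by it multiplies both sides of every relation by [p]. *)
Lemma sphere_rel_cut q (p : A) l : p * p = p -> star p = p ->
  {in l, forall v, v * p = p * v} -> sphere_rel q l -> sphere_rel q [seq v * p | v <- l].
Proof.
move=> pp sp; elim: l => //= z l IHl lp [r1 r2 r3 rel].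
have zp : z * p = p * z by rewrite lp ?mem_head.
have {}lp : {in l, forall v, v * p = p * v} by move=> v vl; rewrite lp // inE vl orbT.
have cut a b : b * p = p * b -> a * p * (b * p) = a * b * p.
  by move=> bp; rewrite -mulrA (mulrA p) -bp -(mulrA b) pp mulrA.
have starp v : v * p = p * v -> star v * p = p * star v.
  by move=> vp; rewrite -sp -!starM vp.
have cutS v : v * p = p * v -> star (v * p) = star v * p.
  by move=> vp; rewrite starM sp starp.
split; last exact: IHl.
- move=> _ /mapP[v vl ->]; have vp := lp v vl.
  by rewrite (cut v z zp) (cut z v vp) r1 // -scalerAl.
- move=> _ /mapP[v vl ->]; have vp := lp v vl.
  by rewrite (cutS v vp) (cut _ z zp) (cut z _ (starp v vp)) r2 // -scalerAl.
- by rewrite (cutS z zp) (cut _ z zp) (cut z _ (starp z zp)) mass_cut // r3 mulrDl -scalerAl.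
Qed.

End Systems.

(** * Dilations along an isometry *)

Section Dilation.
Context {R : realType} {A : cstarAlgType R}.
Variables (e s : A).
Hypotheses (ee : e * e = e) (se : star e = e).
Hypotheses (sse : star s * s = e) (es : e * s = s) (s_e : s * e = s).
Implicit Types (a b v : A) (c : R).

(** [b] is the sum of the [c ^+ k s ^+ k a (s ^+ k)^*], a block diagonal
    operator with blocks [a, c a, c ^+ 2 a, ...].  The fixed point equation
    determines this sum and does not mention convergence. *)
Definition dilates c a b : Prop :=
  [/\ a * s = 0, star s * a = 0, e * b = b, b * e = b
    & b = a + c%:C *: (s * b * star s)].

Lemma isometry_norm_le1 : cnorm s <= 1.
Proof.
apply: cnorm_isometry_le1; rewrite sse; apply: cnorm_proj_le1.
by rewrite se ee.
Qed.

Lemma cnorm_compress_le c b : cnorm (c%:C *: (s * b * star s)) <= `|c| * cnorm b.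
Proof.
rewrite cnormZR; apply: ler_wpM2l => //.
have s1 := isometry_norm_le1; have s0 := cnorm_ge0 s.
have h1 := cnormM_le (s * b) (star s); rewrite cnorm_star in h1.
have h2 := cnormM_le s b; have b0 := cnorm_ge0 b; have sb0 := cnorm_ge0 (s * b).
nra.
Qed.

Lemma dilates_fixed_unique c a b b' : `|c| < 1 ->
  b = a + c%:C *: (s * b * star s) -> b' = a + c%:C *: (s * b' * star s) -> b = b'.
Proof.
move=> c1 bE b'E; apply/eqP; rewrite -subr_eq0; apply/eqP.
apply: (contraction_eq0 c1); rewrite {1}bE {1}b'E.
rewrite opprD addrACA subrr add0r -scalerBr -mulrBl -mulrBr.
exact: cnorm_compress_le.
Qed.

Lemma dilates_unique c a b b' : `|c| < 1 -> dilates c a b -> dilates c a b' -> b = b'.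
Proof. by move=> c1 [_ _ _ _ bE] [_ _ _ _ b'E]; exact: dilates_fixed_unique bE b'E. Qed.

Lemma star_se : star s * e = star s.
Proof. by rewrite -se -starM es. Qed.

Lemma dilates_exists c a : `|c| < 1 -> e * a = a -> a * e = a -> a * s = 0 ->
  star s * a = 0 -> exists b, dilates c a b.
Proof.
move=> c1 ea ae as0 sa0.
have c01 : 0 <= `|c| < 1 by rewrite normr_ge0.
have [x y|x|b bE] := @affine_fixpoint R A (fun b => c%:C *: (s * b * star s)) `|c| a c01.
- by rewrite -scalerBr -mulrBl -mulrBr.
- exact: cnorm_compress_le.
exists b; split=> //.
- by rewrite bE mulrDr ea -scalerAr !mulrA es.
- by rewrite bE mulrDl ae -scalerAl -!mulrA star_se.
Qed.

Lemma dilates_mul c c' a a' b b' : dilates c a b -> dilates c' a' b' ->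
  dilates (c * c') (a * a') (b * b').
Proof.
move=> [as0 sa0 eb be bE] [a's0 sa'0 eb' b'e b'E]; split.
- by rewrite -mulrA a's0 mulr0.
- by rewrite mulrA sa0 mul0r.
- by rewrite mulrA eb.
- by rewrite -mulrA b'e.
rewrite {1}bE {1}b'E mulrDl !mulrDr -!scalerAl -!scalerAr.
have -> : a * (s * b' * star s) = 0 by rewrite !mulrA as0 !mul0r.
have -> : s * b * star s * a' = 0 by rewrite -!mulrA sa'0 !mulr0.
rewrite !scaler0 addr0 add0r scalerA -rmorphM; congr (_ + _ *: _).
by rewrite !mulrA -[_ * star s * s]mulrA sse -[s * b * e]mulrA be.
Qed.

Lemma dilates_star c a b : dilates c a b -> dilates c (star a) (star b).
Proof.
move=> [as0 sa0 eb be bE]; split.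
- by rewrite -[s]starK -starM sa0 star0.
- by rewrite -starM as0 star0.
- by rewrite -{1}se -starM be.
- by rewrite -{1}se -starM eb.
by rewrite {1}bE starD star_scaleR !starM starK mulrA.
Qed.

Lemma dilates_add c a a' b b' : dilates c a b -> dilates c a' b' ->
  dilates c (a + a') (b + b').
Proof.
move=> [as0 sa0 eb be bE] [a's0 sa'0 eb' b'e b'E]; split.
- by rewrite mulrDl as0 a's0 addr0.
- by rewrite mulrDr sa0 sa'0 addr0.
- by rewrite mulrDr eb eb'.
- by rewrite mulrDl be b'e.
by rewrite {1}bE {1}b'E addrACA -scalerDr -mulrDl -mulrDr.
Qed.

Lemma dilates_scale c k a b : dilates c a b -> dilates c (k%:C *: a) (k%:C *: b).
Proof.
move=> [as0 sa0 eb be bE]; split.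
- by rewrite -scalerAl as0 scaler0.
- by rewrite -scalerAr sa0 scaler0.
- by rewrite -scalerAr eb.
- by rewrite -scalerAl be.
by rewrite {1}bE scalerDr -scalerAr -scalerAl !scalerA mulrC.
Qed.

Lemma dilates0 c : dilates c 0 0.
Proof. by split; rewrite ?mulr0 ?mul0r // scaler0 addr0. Qed.

Lemma dilates_mass c (g : A -> A) ws : {in ws, forall v, dilates c v (g v)} ->
  dilates (c * c) (mass ws) (mass (map g ws)).
Proof.
elim: ws => [|v ws IHws] gP; first by rewrite !mass_nil; exact: dilates0.
rewrite /= !mass_cons; have gv := gP v (mem_head _ _).
apply: dilates_add; first exact/dilates_mul/dilates_star.
by apply: IHws => u uws; apply: gP; rewrite inE uws orbT.
Qed.

(** The relations among the generators are homogeneous of degree two, and a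
    dilation is determined by its corner block. *)
Lemma sphere_rel_dilate c q (g : A -> A) ws : `|c * c| < 1 ->
  {in ws, forall v, dilates c v (g v)} -> sphere_rel q ws -> sphere_rel q (map g ws).
Proof.
move=> c1; elim: ws => //= v ws IHws gP [r1 r2 r3 rws].
have gv := gP v (mem_head _ _).
have gws : {in ws, forall u, dilates c u (g u)}.
  by move=> u uws; apply: gP; rewrite inE uws orbT.
split; last exact: IHws.
- move=> _ /mapP[u uws ->]; have gu := gws u uws.
  apply: (dilates_unique c1 (dilates_mul gu gv)); rewrite r1 //.
  exact/dilates_scale/dilates_mul.
- move=> _ /mapP[u uws ->]; have gu := dilates_star (gws u uws).
  apply: (dilates_unique c1 (dilates_mul gu gv)); rewrite r2 //.
  exact/dilates_scale/dilates_mul.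
- have gv' := dilates_star gv.
  apply: (dilates_unique c1 (dilates_mul gv' gv)); rewrite r3.
  by apply: dilates_add; [exact: dilates_mul|exact/dilates_scale/dilates_mass].
Qed.

End Dilation.

(** * The polar link between the two kinds of systems *)

(** The list [ss] collects the isometric parts of [zs]: the first generator [z] has
    polar decomposition [s (1 - w)], where [1 - w] is the square root of [z^* z] up
    to the unit of the corner; the other generators dilate their cut-downs by
    [p = e - s s^*]; and these cut-downs are linked to the rest of [ss]. *)
Fixpoint polar_link {R : realType} {A : cstarAlgType R} (q : R) (e : A) (ss zs : seq A)
    {struct ss} : Prop :=
  match ss, zs with
  | [::], [::] => True
  | s :: ss', z :: zs' =>
    let p := e - s * star s in
    [/\ exists2 w, sqrt_defect ((q ^+ 2)%:C *: mass zs') w & z = s * (1 - w),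
        {in zs', forall v, v = v * p + q%:C *: (s * v * star s)}
      & polar_link q p ss' [seq v * p | v <- zs']]
  | _, _ => False
  end.

Section Link.
Context {R : realType}.

(** The square root [1 - w] depends on [zs] only and is invertible, so it can be
    divided out. *)
Lemma polar_link_unique_isometries (A : cstarAlgType R) q (e : A) ss ss' zs :
  polar_link q e ss zs -> polar_link q e ss' zs -> ss = ss'.
Proof.
elim: ss e ss' zs => [|s ss IHss] e [|s' ss'] [|z zs] //=.
move=> [[w hw zE] _ lk] [[w' hw' zE'] _ lk'].
have ss'E : s = s'.
  by apply: (sqrt_defect_cancel (proj1 hw)); rewrite -zE zE' (sqrt_defect_unique hw hw').
by subst s'; rewrite (IHss _ _ _ lk lk').
Qed.

(** At [q = 0] the remaining generators have ranges and supports orthogonal to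
    the range of [s], so they lie in the corner of [e - s s^*] already. *)
Lemma sphere_system0_tail (A : cstarAlgType R) (e s : A) ss :
  sphere_system 0 e (s :: ss) ->
  star s * s = e /\ sphere_system 0 (e - s * star s) ss.
Proof.
case=> ee se me [r1 r2 r3 rss] supp; have [es s_e] := supp s (mem_head _ _).
have sse : star s * s = e.
  by rewrite r3 expr0n subr0 scale1r -mass_cons.
have [pp sp _ _ _] := range_compl_proj ee se sse es s_e.
split=> //; split=> //; first by rewrite -me mass_cons addrC addKr.
move=> v vss; have [ev ve] := supp v (mem_behead (s := _ :: _) vss).
have vs : v * s = 0 by rewrite r1 // scale0r.
have sv : star s * v = 0 by rewrite -[v]starK -starM r2 // scale0r star0.
rewrite mulrBl mulrBr -mulrA sv mulr0 ev; split; first by rewrite subr0.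
by rewrite mulrA vs mul0r ve subr0.
Qed.

(** By induction the cut-downs agree, a dilation is determined by its corner block,
    and the first generator is a function of the others and of [s]. *)
Lemma polar_link_unique_gens (A : cstarAlgType R) q (e : A) ss zs zs' : `|q| < 1 ->
  sphere_system 0 e ss -> polar_link q e ss zs -> polar_link q e ss zs' -> zs = zs'.
Proof.
move=> q1; elim: ss e zs zs' => [|s ss IHss] e [|z zs] [|z' zs'] //= sys.
move=> [[w hw zE] dil lk] [[w' hw' zE'] dil' lk'].
have [sse syst] := sphere_system0_tail sys; have mE := IHss _ _ _ syst lk lk'.
have [ee se _ _ _] := sys.
have zsE : zs = zs'.
  move: dil dil' mE; move: (e - _) => p; clear -sse ee se q1.
  elim: zs zs' => [|v zs IHzs] [|v' zs'] //= dil dil' [vE mE].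
  congr (_ :: _).
    apply: (dilates_fixed_unique ee se sse q1 (dil v (mem_head _ _))).
    by rewrite vE; apply: dil'; exact: mem_head.
  by apply: IHzs => // u uzs; [apply: dil|apply: dil']; rewrite inE uzs orbT.
by subst zs'; rewrite zE zE' (sqrt_defect_unique hw hw').
Qed.

Lemma mass_hom (A B : starAlgType R) (f : A -> B) l : star_hom f ->
  f (mass l) = mass (map f l).
Proof.
move=> fh; have [_ _ fM fS] := fh; elim: l => [|v l IHl]; first by rewrite !mass_nil star_hom0.
by rewrite /= !mass_cons star_homD // fM fS IHl.
Qed.

(** All clauses of the link are equations between elements, except for the bound on
    [w], which survives because homomorphisms are contractive. *)
Lemma polar_link_hom (A B : cstarAlgType R) (f : A -> B) q (e : A) ss zs :
  star_hom f -> polar_link q e ss zs -> polar_link q (f e) (map f ss) (map f zs).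
Proof.
move=> fh; have [_ f1 fM fS] := fh.
elim: ss e zs => [|s ss IHss] e [|z zs] //= [[w hw zE] dil lk].
have pE : f (e - s * star s) = f e - f s * star (f s) by rewrite star_homB // fM fS.
split.
- exists (f w); last by rewrite zE fM star_homB // f1.
  by rewrite -mass_hom // -star_homZ //; exact: sqrt_defect_hom.
- move=> _ /mapP[v vzs ->]; rewrite {1}(dil v vzs) star_homD // star_homZ //.
  by rewrite !fM pE fS.
- rewrite -pE; set p := e - _ in lk *.
  have -> : [seq v * f p | v <- map f zs] = map f [seq v * p | v <- zs].
    by rewrite -!map_comp; apply: eq_map => v /=; rewrite fM.
  exact: IHss.
Qed.

(** Since [p] is a projection, [x ^+ m] dilates [p] with ratio [c ^+ m], and so the
    powers of [x] are bounded. *)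
Lemma dilated_proj_norm_le1 (A : cstarAlgType R) (e s p x : A) (c : R) :
  e * e = e -> star e = e -> star s * s = e -> e * s = s -> s * e = s ->
  0 <= c < 1 -> p * p = p -> star p = p -> star x = x ->
  dilates e s c p x -> cnorm x <= 1.
Proof.
move=> ee se sse es s_e /andP[c0 c1] pp sp sx dx.
have bnd m : dilates e s (c ^+ m.+1) p (x ^+ m.+1).
  elim: m => [|m IHm]; first by rewrite !expr1.
  by rewrite exprS [x ^+ _]exprS -pp; exact: dilates_mul.
have d0 : 0 < 1 - c by rewrite subr_gt0.
apply: (@cnorm_le_power_growth R A (1 - c)^-1 _ 1) => // -[|m] // _.
rewrite expr1n mulr1; have [_ _ _ _ xE] := bnd m.
have h := cnormD_le p ((c ^+ m.+1)%:C *: (s * x ^+ m.+1 * star s)); rewrite -xE in h.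
have h2 := cnorm_compress_le ee se sse (c ^+ m.+1) (x ^+ m.+1).
have hp : cnorm p <= 1 by apply: cnorm_proj_le1; rewrite sp.
have cm : `|c ^+ m.+1| <= c.
  by rewrite ger0_norm ?exprn_ge0 // exprS ler_piMr // exprn_ile1 // ltW.
rewrite -[_^-1]mul1r ler_pdivlMr //; have := cnorm_ge0 (x ^+ m.+1); nra.
Qed.

(** With [ws] linked to the tail of [ss] by induction, dilate each of its members
    and put [x] for the sum of the [v v^*] over these dilations.  This [x] dilates
    [p], hence has norm at most 1, commutes with the dilations, and supplies the
    missing generator [z = s (1 - q^2 x)^(1/2)]. *)
Lemma generators_exist (A : cstarAlgType R) q (e : A) ss : 0 < q < 1 ->
  sphere_system 0 e ss -> exists2 zs, sphere_system q e zs & polar_link q e ss zs.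
Proof.
move=> q01; have /andP[q0 q1] := q01; have qq1 : q * q < 1 by nra.
have nq : `|q| < 1 by rewrite gtr0_norm.
have nqq : `|q * q| < 1 by rewrite gtr0_norm ?mulr_gt0.
have nqqq : `|q * (q * q)| < 1 by rewrite gtr0_norm ?mulr_gt0 //; nra.
elim: ss e => [|s ss IHss] e sys.
  by exists [::] => //; case: sys => *; split.
have [ee se me _ supp] := sys; have [es s_e] := supp s (mem_head _ _).
have [sse syst] := sphere_system0_tail sys; have [ws wsys lk] := IHss _ syst.
have [pp sp ps s'p [ep pe]] := range_compl_proj ee se sse es s_e.
set p := e - s * star s in syst ws wsys lk pp sp ps s'p ep pe.
have [_ _ wp wrel wsupp] := wsys.
have wdil w : exists z, w \in ws -> dilates e s q w z.
  (* outside [ws] the value is irrelevant *)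
  have [wws|] := boolP (w \in ws); last by exists 0.
  have [pw wp_] := wsupp w wws; have [||||z dz] := @dilates_exists R A e s ee se sse es q w nq.
  - by rewrite -pw mulrA ep.
  - by rewrite -wp_ -mulrA pe.
  - by rewrite -wp_ -mulrA ps mulr0.
  - by rewrite -pw mulrA s'p mul0r.
  by exists z.
have [g gP] := choice wdil; pose x := mass (map g ws).
have {}gP : {in ws, forall w, dilates e s q w (g w)} by move=> w /gP.
have gp u : u \in ws -> g u * p = u.
  move=> uws; have [_ _ _ _ ->] := gP u uws; have [_ u_p] := wsupp u uws.
  by rewrite mulrDl u_p -scalerAl -(mulrA (s * _)) s'p mulr0 scaler0 addr0.
have dx : dilates e s (q * q) p x.
  by rewrite -wp; exact: dilates_mass.
have sx : star x = x := star_mass _.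
have [_ _ ex xe xE] := dx.
have x1 : cnorm x <= 1.
  by apply: (dilated_proj_norm_le1 (c := q * q) ee se sse es s_e) dx; rewrite ?mulr_ge0 ?ltW.
have y1 : cnorm ((q ^+ 2)%:C *: x) < 1.
  by rewrite cnormZR ger0_norm ?exprn_ge0 ?ltW // expr2; have := cnorm_ge0 x; nra.
have [w hw] := sqrt_defect_exists y1.
have sw : star w = w by apply: (sqrt_defect_star hw); rewrite star_scaleR sx.
have ew : e * w = w by apply: (sqrt_defect_corner hw); rewrite -scalerAr ex.
have we : w * e = w by rewrite -{1}sw -se -starM ew.
have sq := sqrt_defectP hw.
have gx v : v \in map g ws -> v * x = x * v.
  case/mapP=> u uws ->; have gu := gP u uws; have [pu u_p] := wsupp u uws.
  apply: (dilates_unique ee se sse nqqq (dilates_mul sse gu dx)).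
  have -> : u * p = p * u by rewrite u_p pu.
  by rewrite [q * (q * q)]mulrC; exact: dilates_mul.
have gw v : v \in map g ws -> v * w = w * v.
  by move=> vws; apply: (sqrt_defect_intertwine hw hw); rewrite -scalerAl -scalerAr gx.
pose z := s * (1 - w).
have gs v : v \in map g ws -> v * s = q%:C *: (s * v).
  case/mapP=> u uws ->; have [us _ _ ge gE] := gP u uws.
  by rewrite {1}gE mulrDl us add0r -scalerAl -!mulrA sse ge.
have g's v : v \in map g ws -> star v * s = q%:C *: (s * star v).
  case/mapP=> u uws ->; have [us _ _ ge gE] := dilates_star se (gP u uws).
  by rewrite {1}gE mulrDl us add0r -scalerAl -!mulrA sse ge.
have zz : z * star z = e - x.
  rewrite /z starM starB star1 sw mulrA -[s * _ * _]mulrA sq.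
  rewrite mulrBr mulr1 mulrBl -scalerAr -scalerAl.
  have -> : s * star s = e - p by rewrite opprB addrC subrK.
  by rewrite expr2 [in RHS]xE (opprD p) addrA.
have z'z : star z * z = e - (q ^+ 2)%:C *: x.
  rewrite /z starM starB star1 sw mulrA -[(1 - w) * _ * _]mulrA sse.
  have c : (1 - w) * e = e * (1 - w) by rewrite mulrBl mulrBr ew we mulr1 mul1r.
  by rewrite c -mulrA sq mulrBr mulr1 -scalerAr ex.
exists (z :: map g ws); last first.
  rewrite /= -/p; split.
  - by exists w.
  - by move=> v /mapP[u uws ->]; rewrite gp //; case: (gP u uws).
  - rewrite -map_comp; suff -> : [seq ((fun v => v * p) \o g) u | u <- ws] = ws by [].
    by rewrite -[RHS]map_id; apply/eq_in_map => u uws /=; exact: gp.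
split=> //.
- by rewrite mass_cons zz subrK.
- split.
  + by move=> v vws; rewrite /z mulrA gs // -scalerAl -!mulrA mulrBr mulrBl gw // mulr1 mul1r.
  + move=> v vws; rewrite /z mulrA g's // -scalerAl -!mulrA mulrBr mulrBl mulr1 mul1r.
    by rewrite -{1}sw -starM -gw // starM sw.
  + rewrite z'z zz rmorphB rmorph1 scalerBl scale1r -/x.
    by rewrite addrA subrK.
  + exact: (sphere_rel_dilate ee se sse nqq gP).
- move=> v; rewrite inE => /orP[/eqP ->|/mapP[u uws ->]].
    rewrite /z mulrA es; split=> //.
    by rewrite -mulrA mulrBl we mul1r mulrBr s_e mulrBr mulr1.
  by have [_ _ ? ? _] := gP u uws.
Qed.

End Link.

(** * From generators to isometries *)

Section Isometries.
Context {R : realType}.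

(** Since [x ^+ m (e - x) = q ^+ (2 m) z x ^+ m z^*], the norms of consecutive powers
    of [x] have quotient at most [1 + q ^+ (2 m) (cnorm z) ^+ 2], which is below
    [q^-1] from some [m] on.  In fact [cnorm x <= 1], but [q^-1] suffices to make
    [q ^+ 2 x] a strict contraction. *)
Lemma q_commuting_norm_le (A : cstarAlgType R) q (e x z : A) : 0 < q < 1 ->
  star x = x -> x * e = x -> z * star z = e - x ->
  x * z = (q ^+ 2)%:C *: (z * x) -> cnorm x <= q^-1.
Proof.
move=> /andP[q0 q1] sx xe zz xz.
have xmz m : x ^+ m * z = ((q ^+ 2) ^+ m)%:C *: (z * x ^+ m).
  elim: m => [|m IHm]; first by rewrite !expr0 scale1r mul1r mulr1.
  rewrite {1}exprS -mulrA IHm -scalerAr (mulrA x z) xz -scalerAl scalerA -mulrA -exprS.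
  by rewrite -rmorphM -exprSr.
have q2m m : 0 <= (q ^+ 2) ^+ m by rewrite !exprn_ge0 // ltW.
have xme m : x ^+ m.+1 * e = x ^+ m.+1 by rewrite exprSr -mulrA xe.
have step m : cnorm (x ^+ m.+2) <=
    (1 + (q ^+ 2) ^+ m.+1 * (cnorm z * cnorm z)) * cnorm (x ^+ m.+1).
  have -> : x ^+ m.+2 = x ^+ m.+1 - ((q ^+ 2) ^+ m.+1)%:C *: (z * x ^+ m.+1 * star z).
    rewrite scalerAl -xmz -mulrA zz mulrBr xme -exprSr opprB addrC.
    by rewrite subrK.
  apply: le_trans (cnormB_le _ _) _; rewrite mulrDl mul1r lerD2l cnormZR.
  rewrite ger0_norm // -(mulrA _ (cnorm z * _)); apply: ler_wpM2l => //.
  rewrite (mulrAC (cnorm z)); apply: le_trans (cnormM_le _ _) _; rewrite cnorm_star.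
  by apply: ler_wpM2r; [exact: cnorm_ge0|exact: cnormM_le].
have c1 : 1 < q^-1 by rewrite invf_gt1.
have qq01 : 0 <= q ^+ 2 < 1 by rewrite exprn_ge0 ?ltW //= expr2; nra.
have gap : 0 < q^-1 - 1 by rewrite subr_gt0.
have [N hN] := expr_small qq01 (mulr_ge0 (cnorm_ge0 z) (cnorm_ge0 z)) gap.
have growth k : cnorm (x ^+ (N + k).+1) <= q^-1 ^+ k * cnorm (x ^+ N.+1).
  elim: k => [|k IHk]; first by rewrite addn0 expr0 mul1r.
  rewrite addnS; apply: le_trans (step _) _; rewrite (exprS q^-1) -(mulrA q^-1).
  apply: ler_pM; rewrite ?cnorm_ge0 //.
    by apply: addr_ge0 => //; apply: mulr_ge0 => //; apply: mulr_ge0; exact: cnorm_ge0.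
  have : (q ^+ 2) ^+ (N + k).+1 <= (q ^+ 2) ^+ N.
    by case/andP: qq01 => p0 p1; apply: ler_wiXn2l => //; [exact: ltW|rewrite leqW // leq_addr].
  have z0 := mulr_ge0 (cnorm_ge0 z) (cnorm_ge0 z); move: hN z0.
  by move: (cnorm z * cnorm z) => M; nra.
apply: (@cnorm_le_power_growth R A (cnorm (x ^+ N.+1)) _ N.+1 x sx).
  by rewrite invr_gt0.
case=> // m; rewrite ltnS => Nm; rewrite -(subnKC Nm).
apply: le_trans (growth _) _; rewrite mulrC; apply: ler_wpM2l; first exact: cnorm_ge0.
by apply: ler_weXn2l; [exact: ltW|rewrite leqW // leq_addl].
Qed.

(** Take [s = z (1 - y)^(-1/2)] with [y = q^2 x].  From [x z = z y] follows
    [x p = p] for [p = e - s s^*], so the cut-downs by [p] have total mass [p]; and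
    [z_j] commutes with [x], hence commutes with [s] up to the factor [q], which
    makes [p] commute with [z_j] and shows that [z_j] dilates [z_j p]. *)
Lemma isometries_exist (A : cstarAlgType R) q (e : A) zs : 0 < q < 1 ->
  sphere_system q e zs -> exists2 ss, sphere_system 0 e ss & polar_link q e ss zs.
Proof.
move=> q01; have /andP[q0 q1] := q01.
have [n] := ubnP (size zs); elim: n => // n IHn in e zs *.
case: zs => [_ sys|z zs /=]; first by exists [::] => //; case: sys => *; split.
rewrite ltnS => zsn sys; have [ee se me [r1 r2 r3 rel] supp] := sys.
have [ez ze] := supp z (mem_head _ _).
have vsupp v : v \in zs -> e * v = v /\ v * e = v.
  by move=> vzs; apply: supp; rewrite inE vzs orbT.
set x := mass zs in r3; have sx : star x = x := star_mass _.
have z'e : star z * e = star z by rewrite -se -starM ez.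
have ez' : e * star z = star z by rewrite -se -starM ze.
have zz : z * star z = e - x by rewrite -me mass_cons addrK.
have ex : e * x = x.
  have -> : x = e - z * star z by rewrite zz opprB addrC subrK.
  by rewrite mulrBr ee mulrA ez.
have xe : x * e = x by rewrite -{1}sx -se -starM ex sx.
set y := (q ^+ 2)%:C *: x.
have z'z : star z * z = e - y.
  by rewrite r3 zz rmorphB rmorph1 scalerBl scale1r addrA subrK.
have xz : x * z = z * y.
  have -> : x * z = (e - z * star z) * z by rewrite zz opprB addrC subrK.
  by rewrite mulrBl -mulrA z'z mulrBr ze ez opprB addrC subrK.
have x_le : cnorm x <= q^-1.
  by apply: q_commuting_norm_le zz _ => //; rewrite xz -scalerAr.
have y1 : cnorm y < 1.
  rewrite cnormZR ger0_norm ?exprn_ge0 ?ltW //; apply: le_lt_trans q1.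
  rewrite expr2 -mulrA -[leRHS]mulr1; apply: ler_wpM2l; first exact: ltW.
  by rewrite -(mulfV (lt0r_neq0 q0)); apply: ler_wpM2l; first exact: ltW.
have sy : star y = y by rewrite star_scaleR sx.
have ye : y * e = y by rewrite -scalerAl xe.
have ey : e * y = y by rewrite -scalerAr ex.
have [w hw] := sqrt_defect_exists y1; have [w1 _] := hw.
have sw := sqrt_defect_star hw sy; have ew := sqrt_defect_corner hw ey.
have we : w * e = w by rewrite -{1}sw -se -starM ew.
have sq := sqrt_defectP hw; have [u [uw wu]] := one_sub_invertible w1.
have su : star u = u.
  have swu : (1 - w) * star u = 1 by rewrite -[1 - w]starK -starM starB star1 sw uw star1.
  by rewrite -[LHS]mul1r -uw -mulrA swu mulr1.
have ucomm a : a * y = y * a -> a * u = u * a.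
  move=> /(sqrt_defect_intertwine hw hw) aw.
  have aw1 : (1 - w) * a = a * (1 - w) by rewrite mulrBl mulrBr aw mul1r mulr1.
  by rewrite -[LHS]mul1r -uw -(mulrA u) (mulrA (1 - w)) aw1 -(mulrA a) wu mulr1.
have ue : u * e = e * u by rewrite ucomm // ye ey.
have ux : u * x = x * u by rewrite ucomm // -scalerAr -scalerAl.
have uuy : (1 - y) * (u * u) = 1.
  by rewrite -sq -mulrA (mulrA (1 - w) u) wu mul1r.
pose s := z * u.
have s_e : s * e = s by rewrite /s -mulrA ue mulrA ze.
have es : e * s = s by rewrite /s mulrA ez.
have sE : star s = u * star z by rewrite starM su.
have zE : z = s * (1 - w) by rewrite /s -mulrA uw mulr1.
have sse : star s * s = e.
  have -> : star s * s = u * (e * (1 - y)) * u.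
    by rewrite sE /s mulrBr mulr1 ey -z'z !mulrA.
  have yu : (1 - y) * u = u * (1 - y) by rewrite ucomm // mulrBl mulrBr mul1r mulr1.
  by rewrite mulrA ue -!mulrA (mulrA u) -yu -(mulrA _ u) uuy mulr1.
have [pp sp ps s'p [ep pe]] := range_compl_proj ee se sse es s_e.
set p := e - s * star s in pp sp ps s'p ep pe.
have ss'E : s * star s = z * (u * u) * star z by rewrite sE /s !mulrA.
have exz : (e - x) * z = z * (1 - y) by rewrite mulrBl ez xz mulrBr mulr1.
have exss : (e - x) * (s * star s) = e - x.
  by rewrite ss'E -(mulrA z) (mulrA (e - x)) exz -(mulrA z) (mulrA (1 - y)) uuy mul1r zz.
have xp : x * p = p.
  apply/eqP; rewrite -subr_eq0 -opprB oppr_eq0 -{1}ep -mulrBl mulrBr exss.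
  by rewrite mulrBl ee xe subrr.
have zsz v : v \in zs -> v * star z = q^-1%:C *: (star z * v).
  move=> vzs; have := congr1 star (r2 v vzs).
  rewrite starM starK star_scaleR starM starK => ->.
  by rewrite scalerA -rmorphM mulVf ?lt0r_neq0 // rmorph1 scale1r.
have vzz v : v \in zs -> v * (z * star z) = z * star z * v.
  move=> vzs; rewrite mulrA r1 // -scalerAl -(mulrA z v) zsz // -scalerAr scalerA.
  by rewrite -rmorphM mulfV ?lt0r_neq0 // rmorph1 scale1r mulrA.
have vx v : v \in zs -> v * x = x * v.
  move=> vzs; have [ev ve] := vsupp v vzs.
  have -> : x = e - z * star z by rewrite zz opprB addrC subrK.
  by rewrite mulrBl mulrBr vzz // ev ve.
have vu v : v \in zs -> v * u = u * v.
  by move=> vzs; apply: ucomm; rewrite -scalerAl -scalerAr vx.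
have comm_s v : v \in zs -> v * s = q%:C *: (s * v).
  by move=> vzs; rewrite /s mulrA r1 // -scalerAl -!mulrA vu.
have comm_s' v : v \in zs -> v * star s = q^-1%:C *: (star s * v).
  by move=> vzs; rewrite sE mulrA vu // -mulrA zsz // -scalerAr mulrA.
have svs v : v \in zs -> q%:C *: (s * v * star s) = s * star s * v.
  move=> vzs; rewrite -mulrA comm_s' // -scalerAr scalerA -rmorphM mulfV ?lt0r_neq0 //.
  by rewrite rmorph1 scale1r mulrA.
have comm_ss v : v \in zs -> v * (s * star s) = s * star s * v.
  by move=> vzs; rewrite mulrA comm_s // -scalerAl svs.
have vp v : v \in zs -> v * p = p * v.
  by move=> vzs; have [ev ve] := vsupp v vzs; rewrite mulrBl mulrBr comm_ss // ev ve.
have [||ss ssys lk] := IHn p [seq v * p | v <- zs].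
- by rewrite size_map.
- split=> //.
  + by rewrite mass_cut.
  + exact: sphere_rel_cut.
  + move=> _ /mapP[v vzs ->]; rewrite -mulrA pp; split=> //.
    by rewrite mulrA -vp // -mulrA pp.
exists (s :: ss); last first.
  split=> //; first by exists w.
  move=> v vzs; have [ev ve] := vsupp v vzs.
  by rewrite svs // -comm_ss // /p mulrBr ve subrK.
have [_ _ mp srel ssupp] := ssys.
split=> //.
- by rewrite mass_cons mp addrC subrK.
- split=> //.
  + move=> v vs; have [_ v_p] := ssupp v vs.
    by rewrite -v_p -mulrA ps mulr0 scale0r.
  + move=> v vs; have [v_p _] := ssupp v vs.
    by rewrite -v_p starM sp -mulrA ps mulr0 scale0r.
  + by rewrite sse expr0n subr0 scale1r mp addrC subrK.
- move=> v; rewrite inE => /orP[/eqP -> //|vs]; have [v_p p_v] := ssupp v vs.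
  by split; [rewrite -v_p mulrA ep|rewrite -p_v -mulrA pe].
Qed.

End Isometries.

(** * Presentations and envelopes *)

Section Presentation.
Context {R : realType}.

Lemma sphere_rel_mkseqP (A : starAlgType R) q (f : nat -> A) m :
  sphere_rel q (mkseq f m) <->
  [/\ forall i j, (i < j < m)%N -> f j * f i = q%:C *: (f i * f j),
      forall i j, (i < j < m)%N -> star (f j) * f i = q%:C *: (f i * star (f j))
    & forall i, (i < m)%N -> star (f i) * f i = f i * star (f i) +
        (1 - q ^+ 2)%:C *: \sum_(i.+1 <= j < m) f j * star (f j)].
Proof.
have mkseqS k (g : nat -> A) : mkseq g k.+1 = g 0%N :: mkseq (g \o succn) k.
  by rewrite /mkseq /= -[1%N]addn0 iotaDl -map_comp.
have massE k (g : nat -> A) : mass (mkseq g k) = \sum_(0 <= j < k) g j * star (g j).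
  by rewrite /mass big_map /index_iota subn0.
elim: m f => [|m IHm] f; first by split=> // _; split=> // i j; rewrite ltn0 andbF.
rewrite mkseqS /= massE; split.
  move=> [r1 r2 r3 /IHm[h1 h2 h3]]; split.
  - case=> [|i] [|j] //= ij; last exact: h1.
    by apply: r1; apply/mapP; exists j; rewrite ?mem_iota.
  - case=> [|i] [|j] //= ij; last exact: h2.
    by apply: r2; apply/mapP; exists j; rewrite ?mem_iota.
  - by case=> [|i] im; rewrite big_add1 //; exact: h3.
move=> [h1 h2 h3]; split.
- by move=> _ /mapP[j + ->]; rewrite mem_iota => jm; exact: h1.
- by move=> _ /mapP[j + ->]; rewrite mem_iota => jm; exact: h2.
- by rewrite h3 // big_add1.
- apply/IHm; split=> [i j ij|i j ij|i im]; [exact: h1|exact: h2|].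
  by have := h3 i.+1 im; rewrite big_add1.
Qed.

Lemma sphere_relationsP (A : starAlgType R) n q (z : 'I_n.+1 -> A) :
  sphere_relations q z <-> sphere_system q 1 (mkseq (z \o inord) n.+1).
Proof.
set f := z \o inord.
have fE (i : 'I_n.+1) : f i = z i by rewrite /f /= inord_val.
have sumE i : \sum_(j < n.+1 | (i < j)%N) z j * star (z j) =
    \sum_(i.+1 <= j < n.+1) f j * star (f j).
  by rewrite big_geq_mkord; apply: eq_bigr => j _; rewrite fE.
have massE : mass (mkseq f n.+1) = \sum_(j < n.+1) z j * star (z j).
  rewrite /mass big_map -[iota _ _]/(index_iota 0 n.+1) big_mkord.
  by apply: eq_bigr => j _; rewrite fE.
split.
  move=> [rA rB rC rD]; split; rewrite ?mulr1 ?star1 ?massE //; last first.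
    by move=> v _; rewrite mulr1 mul1r.
  apply/sphere_rel_mkseqP; split.
  - move=> i j /andP[ij jn]; have := rA (Ordinal (ltn_trans ij jn)) (Ordinal jn) ij.
    by rewrite -!fE.
  - move=> i j /andP[ij jn].
    have := rB (Ordinal jn) (Ordinal (ltn_trans ij jn)); rewrite -!fE; apply.
    by rewrite -val_eqE /= gtn_eqF.
  - by move=> i im; have := rC (Ordinal im); rewrite -!fE sumE.
move=> [_ _ m1 /sphere_rel_mkseqP[h1 h2 h3] _]; split; last by rewrite -massE.
- by move=> i j ij; rewrite -!fE h1 // ij ltn_ord.
- move=> i j; rewrite -val_eqE neq_ltn -!fE => /orP[ij|ji]; last by rewrite h2 // ji ltn_ord.
  have := congr1 star (h2 i j _); rewrite ij ltn_ord starM starK star_scaleR starM starK.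
  by apply.
- by move=> i; rewrite sumE -!fE h3.
Qed.

Lemma polar_link_size (A : cstarAlgType R) q (e : A) ss zs :
  polar_link q e ss zs -> size ss = size zs.
Proof.
elim: ss e zs => [|s ss IHss] e [|z zs] //= [_ _ /IHss ->].
by rewrite size_map.
Qed.

Lemma mkseq_nth_inord (T : Type) (x0 : T) n (l : seq T) : size l = n.+1 ->
  mkseq ((fun i : 'I_n.+1 => nth x0 l i) \o inord) n.+1 = l.
Proof.
move=> ln; apply: (@eq_from_nth _ x0); rewrite size_mkseq ?ln // => i im.
by rewrite nth_mkseq //= inordK.
Qed.

Lemma sphere_relations_hom (A B : starAlgType R) n q (f : A -> B) (z : 'I_n.+1 -> A) :
  star_hom f -> sphere_relations q z -> sphere_relations q (f \o z).
Proof.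
move=> fh; have [_ f1 fM fS] := fh.
have fsum (P : pred 'I_n.+1) : f (\sum_(j | P j) z j * star (z j)) =
    \sum_(j | P j) f (z j) * star (f (z j)).
  rewrite (big_morph f (star_homD fh) (star_hom0 fh)).
  by apply: eq_bigr => j _; rewrite fM fS.
case=> rA rB rC rD; split=> /=.
- by move=> i j ij; rewrite -!fM rA // star_homZ.
- by move=> i j ij; rewrite -!fS -!fM rB // star_homZ.
- by move=> i; rewrite -!fS -!fM rC star_homD // star_homZ // fsum fM fS.
- by rewrite -fsum rD.
Qed.

Section Envelope.
Variables (n : nat) (q : R) (U : cstarAlgType R) (phi : sphere_alg n q -> U).
Hypothesis env : cstar_envelope phi.
Let gen i := phi (sphere_gen q i).

Lemma envelope_gen_relations : sphere_relations q gen.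
Proof. exact: (sphere_relations_hom (proj1 env) (sphere_gen_relations n q)). Qed.

Lemma envelope_hom_exists (C : cstarAlgType R) (z : 'I_n.+1 -> C) :
  sphere_relations q z -> exists2 g : U -> C, star_hom g & forall i, g (gen i) = z i.
Proof.
move=> /sphere_alg_universal[f [[fh fz] _]].
have [g [[gh fE] _]] := env.2 C f fh.
by exists g => // i; rewrite -fz fE.
Qed.

(** Composed with [phi], both homomorphisms become the one given by the
    presentation, and the envelope allows a single extension. *)
Lemma envelope_hom_unique (C : cstarAlgType R) (g g' : U -> C) :
  star_hom g -> star_hom g' -> (forall i, g (gen i) = g' (gen i)) -> g = g'.
Proof.
move=> gh g'h gg'.
have [f [_ f_unique]] :=
  sphere_alg_universal (sphere_relations_hom gh envelope_gen_relations).
have gphi : f = g \o phi by apply: f_unique; split=> //; exact: star_hom_comp env.1 gh.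
have g'phi : f = g' \o phi.
  by apply: f_unique; split=> [|i]; [exact: star_hom_comp env.1 g'h|rewrite /= gg'].
have fh : star_hom f by rewrite gphi; exact: star_hom_comp env.1 gh.
have [h [_ h_unique]] := env.2 C f fh.
by rewrite -(h_unique g) // -(h_unique g').
Qed.

End Envelope.

End Presentation.

Theorem theorem3p22 (R : realType) (n : nat) (q : R) (hq : 0 < q < 1)
    (Cq C0 : cstarAlgType R)
    (phiq : sphere_alg n q -> Cq) (phi0 : sphere_alg n (0 : R) -> C0)
    (hCq : cstar_envelope phiq) (hC0 : cstar_envelope phi0) :
  cstar_isomorphic Cq C0.
Proof.
have nq : `|q| < 1 by case/andP: hq => q0 q1; rewrite gtr0_norm.
pose zq i := phiq (sphere_gen q i); pose s0 i := phi0 (sphere_gen 0 i).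
pose lq := mkseq (zq \o inord) n.+1; pose l0 := mkseq (s0 \o inord) n.+1.
have lqE (i : 'I_n.+1) : nth 0 lq i = zq i by rewrite nth_mkseq //= inord_val.
have l0E (i : 'I_n.+1) : nth 0 l0 i = s0 i by rewrite nth_mkseq //= inord_val.
have sysq : sphere_system q 1 lq := (sphere_relationsP _ _).1 (envelope_gen_relations hCq).
have sys0 : sphere_system 0 1 l0 := (sphere_relationsP _ _).1 (envelope_gen_relations hC0).
have [ss ssys slk] := isometries_exist hq sysq.
have [zs zsys zlk] := generators_exist hq sys0.
have ssE := mkseq_nth_inord (n := n) 0 (l := ss).
rewrite (polar_link_size slk) size_mkseq in ssE; have {}ssE := ssE erefl.
have zsE := mkseq_nth_inord (n := n) 0 (l := zs).
rewrite -(polar_link_size zlk) size_mkseq in zsE; have {}zsE := zsE erefl.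
set s := (fun i : 'I_n.+1 => _) in ssE; set z := (fun i : 'I_n.+1 => _) in zsE.
have srel : sphere_relations 0 s by apply/sphere_relationsP; rewrite ssE.
have zrel : sphere_relations q z by apply/sphere_relationsP; rewrite zsE.
have [f fh fE] := envelope_hom_exists hC0 srel.
have [g gh gE] := envelope_hom_exists hCq zrel.
have fl0 : map f l0 = ss.
  by rewrite -ssE /l0 /mkseq -map_comp; apply: eq_map => i /=; rewrite fE.
have glq : map g lq = zs.
  by rewrite -zsE /lq /mkseq -map_comp; apply: eq_map => i /=; rewrite gE.
have f1 : f 1 = 1 by case: fh.
have g1 : g 1 = 1 by case: gh.
have gss : map g ss = l0.
  have := polar_link_hom gh slk; rewrite g1 glq => lk.
  exact: polar_link_unique_isometries lk zlk.
have fzs : map f zs = lq.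
  have := polar_link_hom fh zlk; rewrite f1 fl0 => lk.
  exact: polar_link_unique_gens nq ssys lk slk.
have fgE : f \o g = idfun.
  apply: (envelope_hom_unique hCq) => [||i]; [exact: star_hom_comp|exact: star_hom_id|].
  have := congr1 (fun l => nth 0 l i) (congr1 (map f) glq).
  by rewrite fzs -map_comp (nth_map 0) ?size_mkseq // lqE.
have gfE : g \o f = idfun.
  apply: (envelope_hom_unique hC0) => [||i]; [exact: star_hom_comp|exact: star_hom_id|].
  have := congr1 (fun l => nth 0 l i) (congr1 (map g) fl0).
  by rewrite gss -map_comp (nth_map 0) ?size_mkseq // l0E.
exists g => //; exists f => x; [exact: (congr1 (@^~ x) fgE)|exact: (congr1 (@^~ x) gfE)].
Qed.
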